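(* Let $f\in\mathbb{Q}(x)$ be the rational function of degree 12 $$f=\frac{x^3(x+6)^3(x^2-6x+36)^3}{(x-3)^3(x^2+3x+9)^3}.$$ Then $f=g_1\circ g_2\circ g_3=h_1\circ h_2$, where $$g_1=x^3,\quad g_2=\frac{x(x-12)}{x-3},\quad g_3=\frac{x(x+6)}{x-3},\quad h_1=\frac{x^3(x+24)}{x-3},\quad h_2=\frac{x(x^2-6x+36)}{x^2+3x+9},$$ and each of $g_1,g_2,g_3,h_1,h_2$ is indecomposable in $\mathbb{Q}(x)$. Hence $f$ has two complete decompositions in $\mathbb{Q}(x)$ of different lengths (3 and 2).
   Context: For a field $\mathbb{K}$ and a non-constant $f=f_N/f_D\in\mathbb{K}(x)$ with $f_N,f_D\in\mathbb{K}[x]$ coprime, $\deg f=\max\{\deg f_N,\deg f_D\}$. Here $\circ$ denotes composition of rational functions, $(g\circ h)(x)=g(h(x))$. The units of $\mathbb{K}(x)$ with respect to composition are the Möbius transformations $(ax+b)/(cx+d)$ with $a,b,c,d\in\mathbb{K}$, $ad-bc\neq0$ (equivalently, the functions of degree 1). A non-constant $f\in\mathbb{K}(x)$ is indecomposable in $\mathbb{K}(x)$ if it is not a unit and whenever $f=g\circ h$ with $g,h\in\mathbb{K}(x)$, at least one of $g,h$ is a unit. A complete decomposition of $f$ in $\mathbb{K}(x)$ is an expression $f=g_1\circ\cdots\circ g_r$ with all $g_i\in\mathbb{K}(x)$ indecomposable in $\mathbb{K}(x)$; $r$ is its length. *)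

(* Defs.v *)
From HB Require Import structures.
From mathcomp Require Import all_boot all_order all_algebra.

Set Implicit Arguments.
Unset Strict Implicit.
Unset Printing Implicit Defensive.

Import GRing.Theory.
Local Open Scope ring_scope.

Notation ratfun K := {fraction {poly K}}.

Section RationalFunctions.
Variable K : fieldType.
Implicit Types f g h : ratfun K.

Definition ratfunX : ratfun K := tofrac 'X.

Definition ratfunC (c : K) : ratfun K := tofrac c%:P.

Definition nonconstant f : Prop := forall c : K, f <> ratfunC c.

(* repr f is an arbitrary numerator/denominator pair representing f; dividing
   by the gcd makes it coprime. The pair is unique up to a common factor in K. *)
Definition ratfun_num f : {poly K} :=
  let r := repr f in \n_r %/ gcdp \n_r \d_r.
Definition ratfun_den f : {poly K} :=
  let r := repr f in \d_r %/ gcdp \n_r \d_r.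

Definition ratfun_deg f : nat :=
  maxn (size (ratfun_num f)).-1 (size (ratfun_den f)).-1.

Definition eval_at (p : {poly K}) h : ratfun K := (map_poly ratfunC p).[h].

(* g o h, i.e. g(h(x)). The only undefined case is h a constant equal to a pole
   of g: there division by zero returns the constant 0. As g o h is constant
   whenever h is, this never affects a decomposition of a nonconstant f. *)
Definition ratfun_comp g h : ratfun K :=
  eval_at (ratfun_num g) h / eval_at (ratfun_den g) h.

(* Units for composition: the two-sided invertible elements, i.e. the
   Moebius transformations. *)
Definition ratfun_unit f : Prop :=
  exists g, ratfun_comp f g = ratfunX /\ ratfun_comp g f = ratfunX.

Definition indecomposable f : Prop :=
  [/\ nonconstant f, ~ ratfun_unit f &
      forall g h, f = ratfun_comp g h -> ratfun_unit g \/ ratfun_unit h].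

(* s = [:: g_1; ...; g_r] with r >= 1 and f = g_1 o (g_2 o ( ... o g_r)); the
   innermost composition g_r o x is g_r. *)
Definition complete_decomposition f (s : seq (ratfun K)) : Prop :=
  [/\ s <> [::],
      forall g, g \in s -> indecomposable g &
      f = foldr ratfun_comp ratfunX s].

End RationalFunctions.

Arguments ratfunX {K}.

Notation "g '\oF' h" := (ratfun_comp g h)
  (at level 50, left associativity) : ring_scope.

(* Main.v *)
Require Import Defs.
From mathcomp Require Import all_boot all_order all_algebra.
From HB Require Import structures.
From mathcomp Require Import ring zify.

(* Writing g = A/B and h = p/q in lowest terms, with deg g = n, one has
   g o h = A^h(p, q) / B^h(p, q), where A^h is the degree n homogenization of A,
   and this is again in lowest terms; hence the degree is multiplicative. The
   units are the functions of degree 1, so functions of prime degree are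
   indecomposable. For h_1, of degree 4, two factors of degree 2 remain to be
   excluded: h_1 has a zero of order exactly 3 at 0, whereas the ramification
   indices of a composition of two quadratic functions are 1, 2 or 4. *)

Import GRing.Theory Num.Theory.
Local Open Scope ring_scope.

Section Reduced.
Variable K : fieldType.
Implicit Types (p q A B : {poly K}) (f g h : ratfun K).

Local Notation frac p q := (tofrac p / tofrac q : ratfun K).

(** * Fractions in lowest terms *)

Lemma repr_frac f : f = frac \n_(generic_quotient.repr f) \d_(generic_quotient.repr f).
Proof.
set r := generic_quotient.repr f.
have d0 : \d_r != 0 by apply: denom_ratioP.
apply: (canRL (mulfK _)); first by rewrite tofrac_eq0.
rewrite -[f]generic_quotient.reprK -/r.
rewrite !generic_quotient.piE; apply/eqP.
rewrite generic_quotient.piE /FracField.equivf /= /FracField.mulf.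
by rewrite !numden_Ratio ?mulr1 ?oner_eq0 ?mul1r // mulrC.
Qed.

(** A lowest-terms pair of degree exactly [n], viewed as two forms of degree [n] without common zero
    on the projective line. It is symmetric in [p] and [q], so [q] may even be zero. *)
Definition reduced n p q :=
  [/\ (size p <= n.+1)%N, (size q <= n.+1)%N, coprimep p q &
      (p`_n != 0) || (q`_n != 0)].

Lemma reduced_sym n p q : reduced n p q -> reduced n q p.
Proof. by case=> ? ? ? ?; split=> //; [rewrite coprimep_sym | rewrite orbC]. Qed.

Lemma coprimep_reduced p q :
  coprimep p q -> reduced (maxn (size p).-1 (size q).-1) p q.
Proof.
move=> cpq; set n := maxn _ _.
have lep (r : {poly K}) : ((size r).-1 <= n)%N -> (size r <= n.+1)%N by case: (size r).
split=> //; try by apply: lep; rewrite ?leq_maxl ?leq_maxr.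
have aux (r : {poly K}) : (size r).-1 = n -> r != 0 -> r`_n != 0.
  by move=> <-; rewrite -lead_coefE lead_coef_eq0.
(* A zero polynomial counts as degree 0 but has no nonzero coefficient, so the other one must supply
   the coefficient at [n]. *)
have [p0|p0] := eqVneq p 0.
  have q0 : q != 0.
    by apply/eqP=> q0; move: cpq; rewrite p0 q0 coprimep_def gcd0p size_poly0.
  by rewrite (aux q) ?orbT // /n p0 size_poly0 max0n.
have [q0|q0] := eqVneq q 0.
  by rewrite (aux p) // /n q0 size_poly0 maxn0.
have [le|/ltnW le] := leqP (size p).-1 (size q).-1.
  by rewrite (aux q) ?orbT // /n; apply/esym/maxn_idPr.
by rewrite (aux p) // /n; apply/esym/maxn_idPl.
Qed.

Lemma reduced_degE n p q : reduced n p q -> maxn (size p).-1 (size q).-1 = n.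
Proof.
case=> sp sq _ nz; apply/eqP; rewrite eqn_leq geq_max; apply/andP; split.
  by rewrite -!subn1 !leq_subLR !add1n sp sq.
have aux (r : {poly K}) : r`_n != 0 -> (n <= (size r).-1)%N.
  move=> rn; have: (n < size r)%N.
    by rewrite ltnNge; apply: contra rn => /leq_sizeP/(_ n (leqnn n))->.
  by case: (size r).
by rewrite leq_max; case/orP: nz => /aux ->; rewrite ?orbT.
Qed.

Lemma ratfun_den_neq0 f : ratfun_den f != 0.
Proof.
rewrite /ratfun_den; set r := generic_quotient.repr f.
have d0 : \d_r != 0 by apply: denom_ratioP.
rewrite dvdp_div_eq0 ?dvdp_gcdr //.
Qed.

Lemma frac_eqE p q p' q' : q != 0 -> q' != 0 ->
  (frac p q == frac p' q') = (p * q' == p' * q).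
Proof.
by move=> q0 q'0; rewrite GRing.eqr_div ?tofrac_eq0 // -!tofracM tofrac_eq.
Qed.

Lemma ratfunE f : f = frac (ratfun_num f) (ratfun_den f).
Proof.
rewrite [LHS]repr_frac; apply/eqP; rewrite frac_eqE ?ratfun_den_neq0 ?denom_ratioP //.
by rewrite divp_mulCA ?dvdp_gcdl ?dvdp_gcdr // mulrC.
Qed.

Lemma coprimep_num_den f : coprimep (ratfun_num f) (ratfun_den f).
Proof. by apply: coprimep_div_gcd; rewrite orbC denom_ratioP. Qed.

Lemma reduced_num_den f : reduced (ratfun_deg f) (ratfun_num f) (ratfun_den f).
Proof. exact: coprimep_reduced (coprimep_num_den f). Qed.

(** After cross-multiplication, Gauss's lemma makes the denominators divide each other; their
    constant ratio passes to the numerators. *)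
Lemma coprimep_frac_inj p q p' q' : coprimep p q -> coprimep p' q' ->
    q != 0 -> q' != 0 -> frac p q = frac p' q' ->
  exists2 c, c != 0 & p = c *: p' /\ q = c *: q'.
Proof.
move=> c1 c2 q0 q'0 /eqP; rewrite frac_eqE // => /eqP e.
have qq' : q %= q'.
  apply/andP; split.
    by rewrite -(Gauss_dvdpr _ (_ : coprimep q p)) 1?coprimep_sym // e dvdp_mull.
  by rewrite -(Gauss_dvdpr _ (_ : coprimep q' p')) 1?coprimep_sym // -e dvdp_mull.
have /eqpf_eq [c c0 qE] := qq'.
exists c => //; split=> //; apply: (mulIf q'0).
by rewrite e qE -scalerAl -scalerAr.
Qed.

(** Since [repr] is arbitrary, this is what allows degrees and compositions to be computed from any
    explicit coprime pair. *)
Lemma num_den_frac p q : coprimep p q -> q != 0 ->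
  exists2 c, c != 0 & ratfun_num (frac p q) = c *: p /\ ratfun_den (frac p q) = c *: q.
Proof.
move=> cpq q0; apply: coprimep_frac_inj => //.
- exact: coprimep_num_den.
- exact: ratfun_den_neq0.
- by rewrite -ratfunE.
Qed.

Lemma ratfun_deg_frac n p q : reduced n p q -> q != 0 -> ratfun_deg (frac p q) = n.
Proof.
move=> r q0; have [_ _ cpq _] := r; have [c c0 [ep eq_]] := num_den_frac _ _ cpq q0.
by rewrite /ratfun_deg ep eq_ !size_scale // (reduced_degE _ _ _ r).
Qed.

(** * Homogenization and composition *)

Definition homog n A p q := \sum_(i < n.+1) A`_i *: (p ^+ i * q ^+ (n - i)).

HB.instance Definition _ := GRing.RMorphism.copy (@ratfunC K) (@tofrac _ \o @polyC K).

(** The exponent [n] need not be the degree of [A]: numerator and denominator of g share one [n], so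
    the powers of [q] cancel in the quotient. *)
Lemma tofrac_homog n A p q : (size A <= n.+1)%N -> q != 0 ->
  tofrac (homog n A p q) = eval_at A (frac p q) * tofrac q ^+ n.
Proof.
move=> sA q0; rewrite /eval_at (horner_coef_wide (n := n.+1)); last first.
  by rewrite (leq_trans (size_poly _ _)).
rewrite mulr_suml rmorph_sum /=; apply: eq_bigr => i _.
rewrite coef_map -mul_polyC !tofracM !tofracXn -!mulrA; congr (_ * _).
rewrite expr_div_n -mulrA; congr (_ * _).
have le : (i <= n)%N by rewrite -ltnS.
have -> : tofrac q ^+ n = tofrac q ^+ i * tofrac q ^+ (n - i) by rewrite -exprD subnKC.
by rewrite mulKf // expf_neq0 // tofrac_eq0.
Qed.

Lemma eval_at_frac n A p q : (size A <= n.+1)%N -> q != 0 ->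
  eval_at A (frac p q) = tofrac (homog n A p q) / tofrac q ^+ n.
Proof.
by move=> sA q0; rewrite tofrac_homog // mulfK // expf_neq0 // tofrac_eq0.
Qed.

Lemma ratfun_comp_eval A B h : coprimep A B -> B != 0 ->
  ratfun_comp (frac A B) h = eval_at A h / eval_at B h.
Proof.
move=> cAB B0; have [c c0 [eA eB]] := num_den_frac _ _ cAB B0.
rewrite /ratfun_comp eA eB /eval_at !map_polyZ !hornerZ -mulf_div divff ?mul1r //.
by rewrite /ratfunC tofrac_eq0 polyC_eq0.
Qed.

Lemma ratfun_comp_frac n A B p q : reduced n A B -> B != 0 -> q != 0 ->
  ratfun_comp (frac A B) (frac p q) = frac (homog n A p q) (homog n B p q).
Proof.
case=> sA sB cAB _ B0 q0; rewrite ratfun_comp_eval // !(eval_at_frac n) //.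
by rewrite invf_div mulrA divfK // expf_neq0 // tofrac_eq0 //.
Qed.

Lemma size_mul_top m k p q : (size p <= m.+1)%N -> (size q <= k.+1)%N ->
  (size (p * q)%R <= (m + k).+1)%N.
Proof.
move=> sp sq.
by rewrite (leq_trans (size_polyMleq _ _)) // -subn1 leq_subLR add1n -addnS -addSn leq_add.
Qed.

(** In the fraction field this is the multiplicativity of evaluation at [p / q]. *)
Lemma homogM n k A B p q : (size A <= n.+1)%N -> (size B <= k.+1)%N -> q != 0 ->
  homog (n + k) (A * B) p q = homog n A p q * homog k B p q.
Proof.
move=> sA sB q0; apply/eqP; rewrite -tofrac_eq tofracM; apply/eqP.
rewrite !tofrac_homog ?size_mul_top //.
by rewrite /eval_at rmorphM hornerM exprD mulrACA.
Qed.

Lemma homogD n A B p q : homog n (A + B) p q = homog n A p q + homog n B p q.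
Proof. by rewrite -big_split; apply: eq_bigr => i _; rewrite coefD scalerDl. Qed.

Lemma homog1 n p q : homog n 1 p q = q ^+ n.
Proof.
rewrite /homog big_ord_recl coef1 scale1r mul1r subn0 big1 ?addr0 // => i _.
by rewrite coef1 scale0r.
Qed.

(* Modulo q only the top coefficient of A survives. *)
Lemma coprimep_homog_den n A p q : coprimep p q -> A`_n != 0 ->
  coprimep (homog n A p q) q.
Proof.
move=> cpq An; rewrite /homog big_ord_recr /= subnn mulr1.
have [r ->] : exists r, \sum_(i < n) A`_i *: (p ^+ i * q ^+ (n - i)) = r * q.
  exists (\sum_(i < n) A`_i *: (p ^+ i * q ^+ (n - i).-1)).
  rewrite mulr_suml; apply: eq_bigr => i _; rewrite -scalerAl -mulrA -exprSr prednK //.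
  by rewrite subn_gt0.
by rewrite coprimep_sym coprimep_addl_mul coprimepZr // coprimep_expr // coprimep_sym.
Qed.

(** Homogenizing a Bezout identity U A + V B = 1 shows that a common divisor divides a power of [q];
    but the homogenization of [A] is coprime to [q] once [A] has a nonzero coefficient at [n], which
    symmetry allows to assume. *)
Lemma coprimep_homog n A B p q : reduced n A B -> coprimep p q ->
  coprimep (homog n A p q) (homog n B p q).
Proof.
move=> rAB cpq; wlog An : A B rAB / A`_n != 0 => [th|].
  have [_ _ _ /orP[]] := rAB; first exact: th.
  by move=> Bn; rewrite coprimep_sym; apply: th => //; apply: reduced_sym.
have cA := coprimep_homog_den n A p q cpq An.
(* For [q] zero, coprimality to [q] already makes the homogenization of [A] a unit. *)
have [q0|q0] := eqVneq q 0.
  move: cA; rewrite q0 coprimep0 => /eqp_coprimepl ->; exact: coprime1p.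
have [sA sB /Bezout_eq1_coprimepP [[U V] /= e] _] := rAB.
apply/coprimepP => d dA dB.
pose k := maxn (size U) (size V).
have sU : (size U <= k.+1)%N by rewrite ltnW // ltnS leq_maxl.
have sV : (size V <= k.+1)%N by rewrite ltnW // ltnS leq_maxr.
have dq : d %| q ^+ (k + n).
  by rewrite -(homog1 _ p) -e homogD !homogM // dvdp_add // dvdp_mull.
exact: (coprimepP _ _ (coprimep_expr (k + n) cA)).
Qed.

Lemma coef_mul_top m k p q : (size p <= m.+1)%N -> (size q <= k.+1)%N ->
  (p * q)`_(m + k) = p`_m * q`_k.
Proof.
move=> sp sq; have lt : (m < (m + k).+1)%N by rewrite ltnS leq_addr.
rewrite coefM (bigD1 (Ordinal lt)) //= addKn big1 ?addr0 // => i.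
rewrite -val_eqE /= neq_ltn => /orP[lim|lmi].
  rewrite (leq_sizeP _ _ sq) ?mulr0 //; lia.
by rewrite (leq_sizeP _ _ sp) ?mul0r.
Qed.

Lemma size_exp_top m p i : (size p <= m.+1)%N -> (size (p ^+ i)%R <= (i * m).+1)%N.
Proof.
move=> sp; elim: i => [|i IH]; first by rewrite expr0 size_poly1.
by rewrite exprS mulSn size_mul_top.
Qed.

Lemma coef_exp_top m p i : (size p <= m.+1)%N -> (p ^+ i)`_(i * m) = p`_m ^+ i.
Proof.
move=> sp; elim: i => [|i IH]; first by rewrite !expr0 coef1.
by rewrite !exprS mulSn coef_mul_top ?IH // size_exp_top.
Qed.

Lemma size_homog n m A p q : (size p <= m.+1)%N -> (size q <= m.+1)%N ->
  (size (homog n A p q) <= (n * m).+1)%N.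
Proof.
move=> sp sq; rewrite /homog; apply: (leq_trans (size_sum _ _ _)).
apply/bigmax_leqP => i _; apply: (leq_trans (size_scale_leq _ _)).
have le : (i <= n)%N by rewrite -ltnS.
have -> : (n * m = i * m + (n - i) * m)%N by rewrite -mulnDl subnKC.
by rewrite size_mul_top // size_exp_top.
Qed.

(** The analogue of evaluation at infinity. Constant polynomials are used so that [coprimep_homog]
    can be applied to the top coefficients themselves. *)
Lemma coef_homog_top n m A p q : (size p <= m.+1)%N -> (size q <= m.+1)%N ->
  ((homog n A p q)`_(n * m))%:P = homog n A (p`_m)%:P (q`_m)%:P.
Proof.
move=> sp sq; rewrite /homog coef_sum rmorph_sum /=; apply: eq_bigr => i _.
have le : (i <= n)%N by rewrite -ltnS.
have -> : (n * m = i * m + (n - i) * m)%N by rewrite -mulnDl subnKC.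
rewrite coefZ coef_mul_top ?size_exp_top // !coef_exp_top //.
by rewrite polyCM polyCM !polyC_exp mul_polyC.
Qed.

Lemma reduced_homog n m A B p q : reduced n A B -> reduced m p q ->
  reduced (n * m) (homog n A p q) (homog n B p q).
Proof.
move=> rAB [sp sq cpq nz]; split; rewrite ?size_homog ?coprimep_homog //.
(* The top coefficients are not both zero, hence coprime as constants; homogenization keeps them
   coprime, so the new top coefficients are not both zero either. *)
have cc : coprimep (p`_m)%:P (q`_m)%:P.
  apply/Bezout_eq1_coprimepP; case/orP: nz => nz.
    by exists ((p`_m)^-1%:P, 0); rewrite /= mul0r addr0 -polyCM mulVf.
  by exists (0, (q`_m)^-1%:P); rewrite /= mul0r add0r -polyCM mulVf.
have := coprimep_homog n A B _ _ rAB cc; rewrite -!coef_homog_top //.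
rewrite -negb_and; apply: contraL => /andP[/eqP-> /eqP->].
by rewrite coprimep_def gcd0p size_poly0.
Qed.

(** * Constants and multiplicativity of the degree *)

Lemma ratfun_deg_eq0 f : ratfun_deg f = 0%N <-> exists c, f = ratfunC c.
Proof.
split=> [d0|[c ->]].
  have := reduced_num_den f; rewrite d0 => -[sp sq _ _].
  exists ((ratfun_num f)`_0 / (ratfun_den f)`_0).
  by rewrite [LHS]ratfunE fmorph_div /= /ratfunC -!size1_polyC.
have -> : ratfunC c = frac c%:P 1 by rewrite tofrac1 divr1.
apply: ratfun_deg_frac; rewrite ?oner_eq0 //.
split; rewrite ?size_polyC ?size_poly1 ?leq_b1 //.
  exact: coprimep1.
by rewrite coef1 oner_eq0 orbT.
Qed.

Lemma nonconstantP f : nonconstant f <-> (0 < ratfun_deg f)%N.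
Proof.
rewrite lt0n; split=> [nc|/eqP d0 c fc].
  by apply/eqP => /ratfun_deg_eq0 [c fc]; apply: (nc c).
by apply: d0; apply/ratfun_deg_eq0; exists c.
Qed.

(* Covers also the junk value 0 of [ratfun_comp g h] at a pole of [g]. *)
Lemma ratfun_comp_const g h : ratfun_deg h = 0%N -> ratfun_deg (ratfun_comp g h) = 0%N.
Proof.
case/ratfun_deg_eq0 => c ->; apply/ratfun_deg_eq0.
exists ((ratfun_num g).[c] / (ratfun_den g).[c]).
by rewrite /ratfun_comp /eval_at !horner_map fmorph_div.
Qed.

Lemma homog_den_neq0 g h : (0 < ratfun_deg h)%N ->
  homog (ratfun_deg g) (ratfun_den g) (ratfun_num h) (ratfun_den h) != 0.
Proof.
move=> h0; have [_ sB _ _] := reduced_num_den g.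
have := reduced_homog _ _ _ _ _ _ (reduced_num_den g) (reduced_num_den h).
set n := ratfun_deg g; set P := homog _ (ratfun_num g) _ _.
case: (eqVneq n 0%N) => [n0 _|n0 [sP _ cP nz]].
  rewrite n0 /homog big_ord1 !mulr1 alg_polyC polyC_eq0.
  move: sB; rewrite -/n n0 => /size1_polyC sB.
  by have := ratfun_den_neq0 g; rewrite {1}sB polyC_eq0.
(* A numerator coprime to 0 is a nonzero constant, yet its coefficient in the positive degree
   [n * ratfun_deg h] would have to be nonzero. *)
apply/eqP => Q0; move: cP nz.
rewrite Q0 coprimep0 coef0 eqxx orbF -size_poly_eq1 => /eqP sP1.
by rewrite nth_default ?eqxx // sP1 muln_gt0 lt0n n0.
Qed.

Lemma ratfun_deg_comp g h : (0 < ratfun_deg h)%N ->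
  ratfun_deg (ratfun_comp g h) = (ratfun_deg g * ratfun_deg h)%N.
Proof.
move=> h0; rewrite {1}[g]ratfunE {1}[h]ratfunE (ratfun_comp_frac (ratfun_deg g));
  rewrite ?ratfun_den_neq0 //; last exact: reduced_num_den.
apply: ratfun_deg_frac (homog_den_neq0 _ _ h0).
by apply: reduced_homog; apply: reduced_num_den.
Qed.

(** * Units are the functions of degree 1 *)

Lemma reducedX : reduced 1 ('X : {poly K}) 1.
Proof. by split; rewrite ?size_polyX ?size_poly1 ?coprimep1 // coefX oner_eq0. Qed.

Lemma ratfunXE : ratfunX = frac 'X 1.
Proof. by rewrite tofrac1 divr1. Qed.

Lemma ratfun_degX : ratfun_deg (ratfunX : ratfun K) = 1%N.
Proof. by rewrite ratfunXE; apply: ratfun_deg_frac (oner_neq0 _); apply: reducedX. Qed.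

Lemma ratfun_compX g : ratfun_comp g ratfunX = g.
Proof.
have evX A : eval_at A (ratfunX : ratfun K) = tofrac A.
  rewrite /eval_at /ratfunX -[LHS]/((map_poly (@tofrac _ \o polyC) A).[tofrac 'X]).
  by rewrite map_poly_comp horner_map -[_.['X]]/(A \Po 'X) comp_polyXr.
by rewrite /ratfun_comp !evX -ratfunE.
Qed.

Lemma ratfun_unit_deg f : ratfun_unit f -> ratfun_deg f = 1%N.
Proof.
case=> g [fg _]; have := ratfun_degX; rewrite -fg.
have [/ratfun_comp_const ->//|g0] := posnP (ratfun_deg g).
by rewrite ratfun_deg_comp // => /eqP; rewrite muln_eq1 => /andP[/eqP].
Qed.

Definition affine (a b : K) : {poly K} := a *: 'X + b%:P.

Lemma coef0_affine a b : (affine a b)`_0 = b.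
Proof. by rewrite coefD coefZ coefX coefC mulr0 add0r. Qed.

Lemma coef1_affine a b : (affine a b)`_1 = a.
Proof. by rewrite coefD coefZ coefX coefC mulr1 addr0. Qed.

Lemma size_affine a b : (size (affine a b) <= 2)%N.
Proof. by apply/leq_sizeP => -[|[|j]] // _; rewrite coefD coefZ coefX coefC mulr0 addr0. Qed.

Lemma affine_coef p : (size p <= 2)%N -> p = affine p`_1 p`_0.
Proof.
move=> sp; apply/polyP => -[|[|j]]; rewrite ?coef0_affine ?coef1_affine //.
have s2 (r : {poly K}) : (size r <= 2)%N -> r`_j.+2 = 0.
  by move=> sr; rewrite nth_default // (leq_trans sr).
by rewrite !s2 // size_affine.
Qed.

Lemma reduced_moebius a b c d : a * d - b * c != 0 -> reduced 1 (affine a b) (affine c d).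
Proof.
move=> D0; split; rewrite ?size_affine ?coef1_affine //.
  apply/Bezout_eq1_coprimepP; set e := (a * d - b * c)^-1.
  (* These come from a(cX + d) - c(aX + b) = ad - bc. *)
  exists ((- e * c)%:P, (e * a)%:P) => /=; rewrite /affine -!mul_polyC.
  rewrite -[RHS]/(1%:P) -(mulVf D0) -/e.
  by rewrite !(polyCM, polyCN, polyCD); ring.
by rewrite -negb_and; apply: contra D0 => /andP[/eqP-> /eqP->]; rewrite mulr0 mul0r subr0.
Qed.

Lemma affine_eq0 a b : (affine a b == 0) = (a == 0) && (b == 0).
Proof.
apply/eqP/andP => [e|[/eqP-> /eqP->]]; last by rewrite /affine scale0r add0r.
by rewrite -(coef1_affine a b) -{2}(coef0_affine a b) e !coef0.
Qed.

(** The inverse comes from the adjugate matrix; the composition is DX / D with D the determinant. *)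
Lemma moebius_compV a b c d : a * d - b * c != 0 ->
  ratfun_comp (frac (affine a b) (affine c d)) (frac (affine d (- b)) (affine (- c) a))
  = ratfunX.
Proof.
move=> D0; rewrite (ratfun_comp_frac 1); first last.
- rewrite affine_eq0 oppr_eq0; apply: contra D0 => /andP[/eqP-> /eqP->].
  by rewrite mulr0 mul0r subr0.
- by rewrite affine_eq0; apply: contra D0 => /andP[/eqP-> /eqP->]; rewrite !mulr0 subr0.
- exact: reduced_moebius.
rewrite /homog !big_ord_recl !big_ord0 /= !coef0_affine !coef1_affine.
rewrite ratfunXE; set D := a * d - b * c in D0.
rewrite !expr0 !expr1 !mul1r !mulr1 !addr0 /affine.
rewrite -!mul_polyC.
have -> : b%:P * ((- c)%:P * 'X + a%:P) + a%:P * (d%:P * 'X + (- b)%:P) = D%:P * 'X.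
  by rewrite /D !(polyCM, polyCN, polyCD); ring.
have -> : d%:P * ((- c)%:P * 'X + a%:P) + c%:P * (d%:P * 'X + (- b)%:P) = D%:P.
  by rewrite /D !(polyCM, polyCN, polyCD); ring.
by apply/eqP; rewrite frac_eqE ?oner_eq0 ?polyC_eq0 // mulr1 mulrC.
Qed.

Lemma ratfun_deg1_unit f : ratfun_deg f = 1%N -> ratfun_unit f.
Proof.
move=> d1; have := reduced_num_den f; rewrite d1 => rf.
have := ratfunE f; have := ratfun_den_neq0 f; case: rf.
move: (ratfun_num f) (ratfun_den f) => p q sp sq cpq nz q0 ->.
set a := p`_1; set b := p`_0; set c := q`_1; set d := q`_0.
(* If the determinant vanished, [a *: q = c *: p]; whichever of a, c is nonzero, the linear
   polynomial it leads would divide the other, against coprimality. *)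
have D0 : a * d - b * c != 0.
  apply/eqP => D0.
  have e : a *: q = c *: p.
    rewrite (affine_coef _ sp) (affine_coef _ sq) /affine -!mul_polyC -/a -/b -/c -/d.
    apply/eqP; rewrite -subr_eq0 -[X in _ == X]/(0%:P) -D0.
    by apply/eqP; rewrite !(polyCM, polyCN, polyCD); ring.
  have aux (r r' : {poly K}) :
      coprimep r r' -> r`_1 *: r' = r'`_1 *: r -> r`_1 != 0 -> False.
    move=> cr er r1; have : r %| r' by rewrite -(dvdpZr _ _ r1) er -mul_polyC dvdp_mull.
    move/(coprimepP _ _ cr _ (dvdpp r)); rewrite -size_poly_eq1 => /eqP sr1.
    by move: r1; rewrite nth_default ?eqxx ?sr1.
  case/orP: nz; first exact: aux cpq e.
  by apply: aux (esym e); rewrite coprimep_sym.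
rewrite (affine_coef _ sp) (affine_coef _ sq) -/a -/b -/c -/d.
exists (frac (affine d (- b)) (affine (- c) a)); split; first exact: moebius_compV.
(* The adjugate has the same determinant and its own adjugate is the original matrix, which gives
   the inverse on the other side. *)
have D0' : d * a - (- b) * (- c) != 0 by rewrite mulrNN mulrC.
by have := moebius_compV _ _ _ _ D0'; rewrite !opprK.
Qed.

(** * Indecomposability criteria *)

Lemma indecomposableP f : (1 < ratfun_deg f)%N ->
  (forall g h, f = ratfun_comp g h ->
    ~ ((1 < ratfun_deg g)%N /\ (1 < ratfun_deg h)%N)) -> indecomposable f.
Proof.
move=> f1 noc; split.
- by apply/nonconstantP/ltnW.
- by move/ratfun_unit_deg => e; rewrite e in f1.
move=> g h e.
have [h0|h0] := posnP (ratfun_deg h).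
  by move: f1; rewrite e ratfun_comp_const.
have dE : ratfun_deg f = (ratfun_deg g * ratfun_deg h)%N by rewrite e ratfun_deg_comp.
have g0 : (0 < ratfun_deg g)%N by move: f1; rewrite dE; case: ratfun_deg.
have [h1|h1] := leqP (ratfun_deg h) 1.
  by right; apply: ratfun_deg1_unit; apply/eqP; rewrite eqn_leq h1.
left; apply: ratfun_deg1_unit; apply/eqP; rewrite eqn_leq g0 andbT leqNgt.
by apply/negP => g1; apply: (noc g h e).
Qed.

Lemma prime_deg_indecomposable f : prime (ratfun_deg f) -> indecomposable f.
Proof.
move=> pr; apply: indecomposableP; first exact: prime_gt1.
move=> g h e [g1 h1]; move: pr; rewrite e ratfun_deg_comp ?(ltnW h1) //.
move=> /primeP [_ /(_ _ (dvdn_mulr _ (dvdnn (ratfun_deg g))))] /orP[] /eqP E; nia.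
Qed.

(** With p = m X + t q the form becomes X m (al m X + de q), where m has degree at most 1. Order
    exactly 3 at 0 fails both for [de] nonzero, by the degree of m, and for [de] zero, by parity. *)
Lemma quadratic_form_no_order3 (al be ga : K) p q N :
  (size p <= 3)%N -> (size q <= 3)%N -> q.[0] != 0 -> N.[0] != 0 ->
  al *: (p * p) + be *: (p * q) + ga *: (q * q) <> 'X^3 * N.
Proof.
move=> sp sq q0 N0 e.
(* Subtracting a multiple of q from p makes p vanish at 0, which removes the
   q * q term from the quadratic form. *)
have [t tE] : exists t, t = p.[0] / q.[0] by exists (p.[0] / q.[0]).
have [m mE] : exists m, p - t *: q = m * 'X.
  have: root (p - t *: q) 0 by rewrite rootE !hornerE tE divfK // subrr.
  by case/factor_theorem => m ->; exists m; rewrite subr0.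
have sm : (size m <= 2)%N.
  have [->|m0] := eqVneq m 0; first by rewrite size_poly0.
  rewrite -ltnS -size_mulX // -mE (leq_trans (size_polyD _ _)) // geq_max sp size_polyN.
  exact: leq_trans (size_scale_leq _ _) sq.
have {mE} pE : p = m * 'X + t *: q by rewrite -mE subrK.
pose de := 2 * al * t + be.
(* The coefficient of q^2 after the substitution; it vanishes because the form does at 0 while q
   does not. *)
have ga0 : al * t ^+ 2 + be * t + ga = 0.
  have := congr1 (horner^~ 0) e; rewrite !hornerE.
  rewrite pE !hornerE expr0n /= mul0r => e0.
  apply: (mulIf q0); apply: (mulIf q0); rewrite !mul0r -[RHS]e0; ring.
have X0 : ('X : {poly K}) != 0 by rewrite polyX_eq0.
have {}e : m * (al *: (m * 'X) + de *: q) = 'X^2 * N.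
  apply: (mulIf X0); rewrite [RHS](_ : _ = 'X^3 * N); last by ring.
  rewrite -e pE (_ : ga = - (al * t ^+ 2 + be * t)); last first.
    by apply/eqP; rewrite -addr_eq0 addrC ga0.
  rewrite /de -!mul_polyC !(polyCM, polyCN, polyCD, polyC_exp); ring.
have NN0 : 'X^2 * N != 0.
  rewrite mulf_neq0 ?expf_neq0 ?polyX_eq0 //; apply: contraNneq N0 => ->.
  by rewrite horner0.
have m0 : m != 0 by apply: contraNneq NN0 => m0; rewrite -e m0 mul0r.
(* For [de] nonzero the cofactor of m does not vanish at 0, so X^2 would divide m. *)
have [d0|d0] := eqVneq de 0; last first.
  have : 'X^2 %| m.
    rewrite -(Gauss_dvdpl _ (_ : coprimep _ (al *: (m * 'X) + de *: q))).
      by rewrite e dvdp_mulr.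
    by rewrite coprimep_expl // coprimep_sym coprimepX rootE
      hornerD !hornerZ hornerM hornerX !mulr0 add0r mulf_neq0.
  by move/(dvdp_leq m0)/leq_trans/(_ sm); rewrite size_polyXn.
(* For [de] zero a scalar multiple of a square would have a simple zero at 0. *)
have {}e : al *: (m * m) = 'X * N.
  apply: (mulIf X0); rewrite [RHS](_ : _ = 'X^2 * N); last by ring.
  by rewrite -e d0 scale0r addr0 -!mul_polyC; ring.
have /factor_theorem [m' m'E] : root m 0.
  have := congr1 (horner^~ 0) e; rewrite hornerZ !hornerM hornerX mul0r.
  move/eqP; rewrite mulf_eq0.
  case/orP => [/eqP al0|]; last by rewrite mulf_eq0 orbb.
  move/eqP: e; rewrite al0 scale0r eq_sym mulf_eq0 (negPf X0) => /eqP N00.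
  by rewrite N00 horner0 eqxx in N0.
have NE : N = al *: (m' * m') * 'X.
  by apply: (mulfI X0); rewrite -e m'E subr0 -!mul_polyC; ring.
by move: N0; rewrite NE hornerM hornerX mulr0 eqxx.
Qed.

Lemma order3_not_comp_deg2 N D g h : coprimep ('X^3 * N) D -> D != 0 -> N.[0] != 0 ->
  ratfun_deg g = 2%N -> ratfun_deg h = 2%N -> frac ('X^3 * N) D <> ratfun_comp g h.
Proof.
move=> cND D0 N0 g2 h2; have h0 : (0 < ratfun_deg h)%N by rewrite h2.
have Q0 := homog_den_neq0 g h h0.
have := reduced_num_den g; have := reduced_num_den h; rewrite g2 h2 in Q0 * => rh rg.
rewrite [g]ratfunE [h]ratfunE (ratfun_comp_frac 2) ?ratfun_den_neq0 //.
have [_ _ cPQ _] := reduced_homog _ _ _ _ _ _ rg rh.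
case/coprimep_frac_inj => // c c0 [e _].
have {}e : homog 2 (ratfun_num g) (ratfun_num h) (ratfun_den h) = 'X^3 * (c^-1 *: N).
  by rewrite -scalerAr e scalerA mulVf // scale1r.
have cN0 : (c^-1 *: N).[0] != 0 by rewrite hornerZ mulf_neq0 ?invr_eq0.
have [sp sq cpq _] := rh.
move: e; rewrite /homog !big_ord_recl big_ord0 /= !(expr0, expr1, mul1r, mulr1, addr0) !expr2.
(* If h has a pole at 0, its numerator is nonzero there by coprimality, and numerator and
   denominator exchange roles in the form. *)
have [q0|q0] := eqVneq (ratfun_den h).[0] 0; last first.
  rewrite addrC [X in X + _]addrC => e.
  exact: (quadratic_form_no_order3 _ _ _ _ _ _ sp sq q0 cN0 e).
rewrite [ratfun_num h * ratfun_den h]mulrC addrA => e.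
apply: (quadratic_form_no_order3 _ _ _ _ _ _ sq sp _ cN0 e).
have rq : root (ratfun_den h) 0 by apply/rootP.
by apply: coprimep_root rq; rewrite coprimep_sym.
Qed.

(** As a ring morphism, evaluation expands explicit polynomials by rewriting. *)
Definition eval_at_rmorph h : {rmorphism {poly K} -> ratfun K} :=
  horner_eval h \o map_poly (@ratfunC K).

Lemma eval_atE h A : eval_at A h = eval_at_rmorph h A.
Proof. by []. Qed.

Lemma eval_at_rmorphX h : eval_at_rmorph h 'X = h.
Proof. by rewrite /eval_at_rmorph /= map_polyX horner_evalE hornerX. Qed.

End Reduced.

(** * The explicit functions over the rationals *)

Lemma coprimep_bezout_nat (u v p q : {poly rat}) n : u * p + v * q = n.+1%:R ->
  coprimep p q.
Proof.
move=> e; apply/Bezout_coprimepP; exists (u, v); rewrite /= e -polyC_natr.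
by rewrite -size_poly_eq1 size_polyC pnatr_eq0.
Qed.

Lemma reduced_Poly n (s t : seq rat) (p q : {poly rat}) : p = Poly s -> q = Poly t ->
  size s = n.+1 -> (size t <= n.+1)%N -> s`_n != 0 -> coprimep p q -> reduced rat n p q.
Proof.
move=> -> -> ss st sn cpq; split=> //; last by rewrite coef_Poly sn.
  by rewrite -ss size_Poly.
exact: leq_trans (size_Poly _) st.
Qed.

Lemma comp3_identity (F : fieldType) (x : F) : x - 3 != 0 -> x ^+ 2 + 3 * x + 9 != 0 ->
  let g3 := x * (x + 6) / (x - 3) in
  (x ^+ 3 * (x + 6) ^+ 3 * (x ^+ 2 - 6 * x + 36) ^+ 3)
    / ((x - 3) ^+ 3 * (x ^+ 2 + 3 * x + 9) ^+ 3) =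
  (g3 * (g3 - 12) / (g3 - 3)) ^+ 3.
Proof.
move=> nz3 nzq /=; field.
(* The denominator g3 - 3 clears to x(x + 6) - 3(x - 3) = x^2 + 3x + 9. *)
by rewrite nz3 (_ : _ + -3 * _ = x ^+ 2 + 3 * x + 9) //; ring.
Qed.

Lemma comp2_identity (F : fieldType) (x : F) : x - 3 != 0 -> x ^+ 2 + 3 * x + 9 != 0 ->
  let h2 := x * (x ^+ 2 - 6 * x + 36) / (x ^+ 2 + 3 * x + 9) in
  (x ^+ 3 * (x + 6) ^+ 3 * (x ^+ 2 - 6 * x + 36) ^+ 3)
    / ((x - 3) ^+ 3 * (x ^+ 2 + 3 * x + 9) ^+ 3) =
  h2 ^+ 3 * (h2 + 24) / (h2 - 3).
Proof.
move=> nz3 nzq /=; field.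
(* The numerator of h2 - 3 is the cube of x - 3. *)
rewrite nzq (_ : _ + -3 * _ = (x - 3) ^+ 3) ?expf_neq0 //; ring.
Qed.

Theorem mainTheorem1 :
  let x : ratfun rat := ratfunX in
  let f := (x ^+ 3 * (x + 6) ^+ 3 * (x ^+ 2 - 6 * x + 36) ^+ 3)
             / ((x - 3) ^+ 3 * (x ^+ 2 + 3 * x + 9) ^+ 3) in
  let g1 := x ^+ 3 in
  let g2 := (x * (x - 12)) / (x - 3) in
  let g3 := (x * (x + 6)) / (x - 3) in
  let h1 := (x ^+ 3 * (x + 24)) / (x - 3) in
  let h2 := (x * (x ^+ 2 - 6 * x + 36)) / (x ^+ 2 + 3 * x + 9) in
  [/\ ratfun_deg f = 12%N,
      f = g1 \oF (g2 \oF g3) /\ f = h1 \oF h2,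
      [/\ indecomposable g1, indecomposable g2, indecomposable g3,
          indecomposable h1 & indecomposable h2] &
      exists s t : seq (ratfun rat),
        [/\ complete_decomposition f s, complete_decomposition f t,
            size s = 3%N & size t = 2%N]].
Proof.
move=> x f g1 g2 g3 h1 h2.
have g1E : g1 = tofrac 'X^3 / tofrac 1 by rewrite tofrac1 divr1 tofracXn.
have g2E : g2 = tofrac ('X * ('X - 12)) / tofrac ('X - 3).
  by rewrite !(tofracM, tofracB, rmorph_nat).
have g3E : g3 = tofrac ('X * ('X + 6)) / tofrac ('X - 3).
  by rewrite !(tofracM, tofracB, tofracD, rmorph_nat).
have h1E : h1 = tofrac ('X^3 * ('X + 24)) / tofrac ('X - 3).
  by rewrite !(tofracM, tofracB, tofracD, tofracXn, rmorph_nat).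
have h2E : h2 = tofrac ('X * ('X^2 - 6 * 'X + 36)) / tofrac ('X^2 + 3 * 'X + 9).
  by rewrite !(tofracM, tofracB, tofracD, tofracXn, rmorph_nat).
have nz (p : {poly rat}) : p.[1] != 0 -> p != 0.
  by move=> p1; apply: contraNneq p1 => ->; rewrite horner0.
have nzX3 : ('X - 3 : {poly rat}) != 0 by rewrite nz ?hornerE.
have nzq : ('X^2 + 3 * 'X + 9 : {poly rat}) != 0 by rewrite nz ?hornerE.
have r1 : reduced rat 3 'X^3 1.
  by split; rewrite ?size_polyXn ?size_poly1 ?coprimep1 // coefXn.
have r2 : reduced rat 2 ('X * ('X - 12)) ('X - 3).
  apply: (reduced_Poly _ [:: 0; -12; 1] [:: -3; 1]) => //;
    try by rewrite /= !cons_poly_def !(polyC0, polyC1, polyCN, polyC_natr); ring.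
  (* Dividing the numerator by X - 3 leaves its value at 3, here -27; the argument 26 encodes 27 as
     a successor. The next two identities arise alike, with values 27 and 729. *)
  by apply: (@coprimep_bezout_nat (-1) ('X - 9) _ _ 26); ring.
have r3 : reduced rat 2 ('X * ('X + 6)) ('X - 3).
  apply: (reduced_Poly _ [:: 0; 6; 1] [:: -3; 1]) => //;
    try by rewrite /= !cons_poly_def !(polyC0, polyC1, polyCN, polyC_natr); ring.
  by apply: (@coprimep_bezout_nat 1 (- ('X + 9)) _ _ 26); ring.
have r4 : reduced rat 4 ('X^3 * ('X + 24)) ('X - 3).
  apply: (reduced_Poly _ [:: 0; 0; 0; 24; 1] [:: -3; 1]) => //;
    try by rewrite /= !cons_poly_def !(polyC0, polyC1, polyCN, polyC_natr); ring.
  by apply: (@coprimep_bezout_nat 1 (- ('X^3 + 27 * 'X^2 + 81 * 'X + 243)) _ _ 728); ring.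
have r5 : reduced rat 3 ('X * ('X^2 - 6 * 'X + 36)) ('X^2 + 3 * 'X + 9).
  apply: (reduced_Poly _ [:: 0; 36; -6; 1] [:: 9; 3; 1]) => //;
    try by rewrite /= !cons_poly_def !(polyC0, polyC1, polyCN, polyC_natr); ring.
  (* Euclid's algorithm: the first remainder is 27(2X + 3), with quotient X - 9, and 4(X^2 + 3X + 9)
     - (2X + 3)^2 = 27; the result is 27^2 = 729. *)
  by apply: (@coprimep_bezout_nat (- (2 * 'X + 3)) (108 + (2 * 'X + 3) * ('X - 9)) _ _ 728);
    ring.
have i1 : indecomposable g1.
  by apply: prime_deg_indecomposable; rewrite g1E (ratfun_deg_frac _ _ _ _ r1) ?oner_neq0.
have i2 : indecomposable g2.
  by apply: prime_deg_indecomposable; rewrite g2E (ratfun_deg_frac _ _ _ _ r2).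
have i3 : indecomposable g3.
  by apply: prime_deg_indecomposable; rewrite g3E (ratfun_deg_frac _ _ _ _ r3).
have d5 : ratfun_deg h2 = 3%N by rewrite h2E (ratfun_deg_frac _ _ _ _ r5).
have i5 : indecomposable h2 by apply: prime_deg_indecomposable; rewrite d5.
have d4 : ratfun_deg h1 = 4%N by rewrite h1E (ratfun_deg_frac _ _ _ _ r4).
have i4 : indecomposable h1.
  apply: indecomposableP => [|g h e [gt1 ht1]]; first by rewrite d4.
  have := d4; rewrite e ratfun_deg_comp ?(ltnW ht1) // => gh.
  have gE : ratfun_deg g = 2%N by nia.
  have hE : ratfun_deg h = 2%N by nia.
  have [_ _ c4 _] := r4.
  (* The cofactor of X^3 is X + 24, nonzero at 0. *)
  by apply: (order3_not_comp_deg2 _ _ _ _ _ c4 _ _ gE hE); rewrite // -?h1E // !hornerE.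
have nzX3' : x - 3 != 0.
  by rewrite (_ : x - 3 = tofrac ('X - 3)) ?tofrac_eq0 // tofracB rmorph_nat.
have nzq' : x ^+ 2 + 3 * x + 9 != 0.
  rewrite (_ : x ^+ 2 + 3 * x + 9 = tofrac ('X^2 + 3 * 'X + 9)) ?tofrac_eq0 //.
  by rewrite !(rmorph_nat, tofracM, tofracD, tofracXn).
have f1 : f = g1 \oF (g2 \oF g3).
  (* Only the outer functions need lowest terms; [g3] enters as a field element, so a field identity
     at [x] remains. *)
  have [_ _ c1 _] := r1; have [_ _ c2 _] := r2.
  rewrite g1E ratfun_comp_eval ?oner_neq0 // g2E ratfun_comp_eval //.
  rewrite !eval_atE !(rmorph_nat, rmorphXn, rmorphM, rmorphB, rmorph1) !eval_at_rmorphX divr1.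
  have := comp3_identity _ _ nzX3' nzq'; rewrite /= -/g3 => I.
  by rewrite -I.
have f2 : f = h1 \oF h2.
  have [_ _ c4 _] := r4.
  rewrite h1E ratfun_comp_eval //.
  rewrite !eval_atE !(rmorph_nat, rmorphXn, rmorphM, rmorphB, rmorphD) !eval_at_rmorphX.
  have := comp2_identity _ _ nzX3' nzq'; rewrite /= -/h2 => I.
  by rewrite -I.
(* The degree 12 is read off the second decomposition as 4 * 3. *)
split=> //; first by rewrite f2 ratfun_deg_comp ?d5 ?d4.
exists [:: g1; g2; g3], [:: h1; h2]; split=> //.
  split=> //=; last by rewrite ratfun_compX.
  by move=> g; rewrite !inE => /or3P[] /eqP->.
split=> //=; last by rewrite ratfun_compX.
by move=> g; rewrite !inE => /orP[] /eqP->.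
Qed.
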